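(* For every integer $n \geq 2$, let $$s(n) = \log n - \max\left\{\log\left(\frac{e^{2+4/e}}{2^{5+4/e}}\left(\log \frac{n}{(\log n)^2}\right)^{3+4/e}\right),\ 2\log(\log n)\right\}.$$ Then for every integer $n\geq 2$, every real number $p\in(0,1)$ and every function $f$ from $\{0,1\}^n$ to $\{0,1\}$, the largest influence of a variable on $f$ is bounded below as follows: $$\max\{I_j(f) : j=1,\ldots,n\} \geq \frac{\mathrm{Var}(f)\,s(n)}{n\,p(1-p)\,c_{\mathrm{LS}}(p)},$$ where $\mathrm{Var}(f)$ is the variance of $f$ under $\mu_{n,p}$.
   Context: Here $\log$ is the natural logarithm. For $p\in[0,1]$, $\mu_{n,p}$ denotes the product Bernoulli probability measure on $\{0,1\}^n$: $\mu_{n,p}(x) = p^{\sum_{i=1}^n x_i}(1-p)^{\sum_{i=1}^n (1-x_i)}$. For $f:\{0,1\}^n\to\{0,1\}$ and $i\in\{1,\ldots,n\}$, the influence of variable $i$ on $f$ (with respect to $p$) is $$I_i(f)=\mu_{n-1,p}\big(\{x\in\{0,1\}^{n-1} : f \text{ is not constant on } l_i(x)\}\big),$$ where $l_i(x)=\{(x_1,\ldots,x_{i-1},u,x_i,\ldots,x_{n-1}) : u\in\{0,1\}\}$. The function $c_{\mathrm{LS}}:(0,1)\to\mathbb{R}$ is defined by $c_{\mathrm{LS}}(p)=\dfrac{\log(1-p)-\log p}{(1-p)-p}$ if $p\neq \frac12$, and $c_{\mathrm{LS}}(\frac12)=2$. *)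

(* Defs.v *)
From HB Require Import structures.
From mathcomp Require Import all_boot all_order all_algebra.
From mathcomp Require Import reals sequences exp.

Set Implicit Arguments.
Unset Strict Implicit.
Unset Printing Implicit Defensive.

Import Order.TTheory GRing.Theory Num.Theory.

Local Open Scope ring_scope.

Definition cube (n : nat) : finType := {ffun 'I_n -> bool}.

Definition bernoulli_weight (R : realType) (n : nat) (p : R) (x : cube n) : R :=
  p ^+ (\sum_(i < n) x i)%N * (1 - p) ^+ (\sum_(i < n) (1 - x i))%N.

Definition bernoulli_measure (R : realType) (n : nat) (p : R)
    (A : {set cube n}) : R :=
  \sum_(x in A) bernoulli_weight p x.

Definition bernoulli_mean (R : realType) (n : nat) (p : R)
    (g : cube n -> R) : R :=
  \sum_(x : cube n) bernoulli_weight p x * g x.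

Definition bernoulli_variance (R : realType) (n : nat) (p : R)
    (g : cube n -> R) : R :=
  bernoulli_mean p (fun x => (g x - bernoulli_mean p g) ^+ 2).

(* The point (x_1, .., x_(i-1), u, x_i, .., x_(n-1)): [unlift i j] is [None]
   for j = i, and otherwise the position of j once i has been removed. *)
Definition insert_coord (n : nat) (i : 'I_n) (u : bool) (x : cube n.-1) :
    cube n :=
  [ffun j => if unlift i j is Some k then x k else u].

Definition line (n : nat) (i : 'I_n) (x : cube n.-1) : {set cube n} :=
  [set insert_coord i u x | u : bool].

Definition constant_on (n : nat) (f : cube n -> bool) (A : {set cube n}) :
    bool :=
  [forall y in A, forall z in A, f y == f z].

Definition influence (R : realType) (n : nat) (p : R) (f : cube n -> bool)
    (i : 'I_n) : R :=
  bernoulli_measure p [set x : cube n.-1 | ~~ constant_on f (line i x)].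

(* Influences are nonnegative, so for n > 0 the default value 0 does not affect
   the maximum. *)
Definition max_influence (R : realType) (n : nat) (p : R)
    (f : cube n -> bool) : R :=
  \big[Num.max/0]_(j < n) influence p f j.

Definition c_LS (R : realType) (p : R) : R :=
  if p == 1 / 2 then 2 else (ln (1 - p) - ln p) / ((1 - p) - p).

(* For n >= 2 every argument of [ln] and every base of a real power below is
   positive, so no junk value of [ln] or [powR] is involved. *)
Definition s (R : realType) (n : nat) : R :=
  let e : R := expR 1 in
  let N : R := n%:R in
  ln N - Num.max
    (ln (e `^ (2 + 4 / e) / 2 `^ (5 + 4 / e)
         * ln (N / ln N ^+ 2) `^ (3 + 4 / e)))
    (2 * ln (ln N)).

(* Main.v *)
Require Import Defs.
From mathcomp Require Import all_boot all_order all_algebra.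
From mathcomp Require Import ring lra.
From mathcomp Require Import boolp classical_sets reals topology normedtype derive.
From mathcomp Require Import realfun sequences exp.

Set Implicit Arguments.
Unset Strict Implicit.
Unset Printing Implicit Defensive.

Import Order.TTheory GRing.Theory Num.Theory.
Import numFieldNormedType.Exports.

Local Open Scope ring_scope.

(** The proof runs on logarithmic Sobolev inequalities and a martingale
    decomposition (the method of Falik, Samorodnitsky and Rossignol).
    Write [q = 1 - p], [c = c_LS p], [V] for the variance of [f] and [m] for its
    largest influence. Averaging [f] over the coordinates one at a time gives
    martingale differences [V_j] with three properties: the sum of the
    [E V_j^2] is [V]; the Dirichlet energies of the [V_j] add up to the energy
    [p q \sum_i I_i(f)] of [f], because resampling a coordinate commutes with
    averaging over another ([sum_energy_mart_diff]); and
    [E |V_j| <= 2 p q I_j(f)], since [V_j] is an average of the fluctuation of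
    [f] in coordinate [j] ([mean_norm_mart_diff]).  So small influences make
    every [V_j] small in L1 relative to L2, hence its square has a large
    entropy, whereas the log-Sobolev inequality bounds the entropy by [c] times
    the energy.  Summing over [j] gives [variance_log_le]:
    [V ln (V / (8 p^2 q^2 n m^2)) <= c p q n m].
    With [t = c p q n m / V], and since [V <= 1/4] and [c >= 2], this reads
    [ln n - 2 ln t <= t]; together with [t >= 2], which is the
    Efron-Stein inequality [variance_le_energy], and with
    [s n <= ln n - 2 ln (ln n)], it forces [s n <= t], which is the claim.

    The log-Sobolev inequality is used in its dual form
    [E (g^2 ln phi) <= c * energy g] for positive densities [phi]
    ([log_sobolev]), which has no trouble with zeros of [g].  Writing [ln phi]
    as a telescoping sum of logarithms of conditional densities reduces it to
    the two-point space.  There it is the statement that the discriminant of a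
    binary quadratic form has the right sign, and this turns out to be the
    superadditivity of the logarithmic mean
    [(a - b) / (ln a - ln b) = \int_0^1 a^(1 - t) b^t dt]: the constant [c_LS p]
    is the inverse of the logarithmic mean of [1 - p] and [p], and the
    integrand is superadditive by the weighted inequality of arithmetic and
    geometric means ([logmean_superadditive]). *)

(** * Superadditivity of the logarithmic mean *)

Section LogarithmicMean.
Variable R : realType.
Implicit Types a b c d t x y : R.

Lemma ln_le_subr1 x : 0 < x -> ln x <= x - 1.
Proof.
move=> x0; rewrite -[x in ln x](subrK 1) addrC; apply: le_ln1Dx.
by rewrite ltrBrDl subrr.
Qed.

Lemma ln_tangent_le x y : 0 < x -> 0 < y -> ln x <= ln y + (x / y - 1).
Proof.
move=> x0 y0; rewrite -lerBlDl -ln_div ?posrE//.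
exact/ln_le_subr1/divr_gt0.
Qed.

Definition geomean a b t := expR ((1 - t) * ln a + t * ln b).

Lemma geomean_le_arith a b t : 0 < a -> 0 < b -> 0 <= t <= 1 ->
  geomean a b t <= (1 - t) * a + t * b.
Proof.
move=> a0 b0 /andP[t0 t1].
have S0 : 0 < (1 - t) * a + t * b.
  have [->|tN0] := eqVneq t 0; first by rewrite subr0 mul1r mul0r addr0.
  rewrite ltr_wpDl ?mulr_ge0 ?subr_ge0 ?(ltW a0)//.
  by rewrite mulr_gt0// lt_def tN0.
set S := (X in _ <= X) in S0 *.
rewrite -[leRHS]lnK ?posrE// ler_expR.
have ha := ler_wpM2l (_ : 0 <= 1 - t) (ln_tangent_le a0 S0).
have hb := ler_wpM2l t0 (ln_tangent_le b0 S0).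
apply: le_trans (lerD (ha _) hb) _; first by rewrite subr_ge0.
rewrite le_eqVlt; apply/orP; left; apply/eqP.
have : (1 - t) * (a / S) + t * (b / S) = 1.
  by rewrite !mulrA -mulrDl divff// gt_eqF.
by move: (a / S) (b / S) (ln S) => u v w h; lra.
Qed.

Lemma geomean_scale a b c d t : 0 < a -> 0 < b -> 0 < c -> 0 < d ->
  geomean (a * c) (b * d) t = geomean a b t * geomean c d t.
Proof. by move=> *; rewrite /geomean !lnM ?posrE// -expRD; congr expR; ring. Qed.

(** Dividing by the right-hand side normalizes both sums to 1, where each term
    is below its weighted arithmetic mean: this is the two-term Hoelder
    inequality with exponents [1 / (1 - t)] and [1 / t]. *)
Lemma geomean_superadditive a b c d t : 0 < a -> 0 < b -> 0 < c -> 0 < d ->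
  0 <= t <= 1 -> geomean a b t + geomean c d t <= geomean (a + c) (b + d) t.
Proof.
move=> a0 b0 c0 d0 t01.
have A0 : 0 < a + c by rewrite addr_gt0.
have B0 : 0 < b + d by rewrite addr_gt0.
have scl u v : 0 < u -> 0 < v -> geomean u v t
    <= ((1 - t) * (u / (a + c)) + t * (v / (b + d))) * geomean (a + c) (b + d) t.
  move=> u0 v0.
  rewrite -{1}[u](divfK (lt0r_neq0 A0)) -{1}[v](divfK (lt0r_neq0 B0)).
  rewrite geomean_scale ?divr_gt0// ler_pM2r ?expR_gt0//.
  by apply: geomean_le_arith => //; exact: divr_gt0.
apply: le_trans (lerD (scl _ _ a0 b0) (scl _ _ c0 d0)) _.
rewrite -mulrDl -[leRHS]mul1r ler_pM2r ?expR_gt0//.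
rewrite le_eqVlt; apply/orP; left; apply/eqP.
by field; apply/andP; split; apply: lt0r_neq0.
Qed.

Definition logmean a b := if a == b then a else (a - b) / (ln a - ln b).

(** An antiderivative of [geomean a b] with respect to [t]; it replaces the
    integral representation of the logarithmic mean. *)
Definition geomean_prim a b t :=
  if a == b then a * t else geomean a b t / (ln b - ln a).

Lemma ln_sub_neq0 a b : 0 < a -> 0 < b -> a != b -> ln b - ln a != 0.
Proof.
move=> a0 b0; apply: contra => /eqP h; apply/eqP/ln_inj; rewrite ?posrE//.
by apply/eqP; rewrite eq_sym -subr_eq0 h.
Qed.

Lemma is_derive_geomean_prim a b t : 0 < a -> 0 < b ->
  is_derive t 1 (geomean_prim a b) (geomean a b t).
Proof.
move=> a0 b0; rewrite /geomean_prim /geomean; have [<-|ab] := eqVneq a b.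
  apply: is_derive_eq.
  rewrite -mulrDl subrK mul1r lnK ?posrE//.
  by rewrite /GRing.scale/= mulr1.
have h := ln_sub_neq0 a0 b0 ab.
apply: is_derive_eq; rewrite /GRing.scale/=.
by field.
Qed.

Lemma geomean_prim_sub a b : 0 < a -> 0 < b ->
  geomean_prim a b 1 - geomean_prim a b 0 = logmean a b.
Proof.
move=> a0 b0; rewrite /geomean_prim /logmean /geomean.
have [_|ab] := eqVneq a b; first by rewrite mulr1 mulr0 subr0.
have h := ln_sub_neq0 a0 b0 ab.
rewrite subrr mul0r add0r mul1r subr0 mul1r mul0r addr0 !lnK ?posrE//.
by field; apply/andP; split=> //; rewrite -oppr_eq0 opprB.
Qed.

(** The logarithmic mean is the integral of [geomean] over [[0, 1]], and
    [geomean] is superadditive for each [t]. *)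
Lemma logmean_superadditive a b c d : 0 < a -> 0 < b -> 0 < c -> 0 < d ->
  logmean a b + logmean c d <= logmean (a + c) (b + d).
Proof.
move=> a0 b0 c0 d0.
have A0 : 0 < a + c by rewrite addr_gt0.
have B0 : 0 < b + d by rewrite addr_gt0.
pose F t := geomean_prim (a + c) (b + d) t - geomean_prim a b t
            - geomean_prim c d t.
pose dF t := geomean (a + c) (b + d) t - geomean a b t - geomean c d t.
have dFP t : is_derive t 1 F (dF t).
  by apply: is_deriveB; [apply: is_deriveB|]; exact: is_derive_geomean_prim.
have dF01 x : x \in `]0, 1[%R -> is_derive x 1 F (dF x) by move=> _; exact: dFP.
have [|t] := MVT_segment ler01 dF01.
  by apply: continuous_subspaceT => t; apply/differentiable_continuous;
    apply/derivable1_diffP; exact: ex_derive.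
rewrite in_itv /= => t01 dFt.
have : 0 <= F 1 - F 0.
  rewrite dFt subr0 mulr1 /dF -addrA -opprD subr_ge0.
  exact: geomean_superadditive.
rewrite -!geomean_prim_sub// /F; lra.
Qed.

Lemma logmeanC a b : logmean a b = logmean b a.
Proof.
rewrite /logmean eq_sym; case: eqVneq => // _.
by rewrite -opprB -[ln a - ln b]opprB invrN mulrNN.
Qed.

Lemma logmean_gt0 a b : 0 < a -> 0 < b -> 0 < logmean a b.
Proof.
move=> a0 b0; wlog ab : a b a0 b0 / a <= b.
  by move=> H; have [/H|/ltW/H] := leP a b; [|rewrite logmeanC]; apply.
rewrite /logmean; case: eqVneq => // /negPf aNb.
have {aNb}ab : a < b by rewrite lt_neqAle aNb.
by rewrite -opprB -[ln a - ln b]opprB invrN mulrNN divr_gt0 ?subr_gt0 ?ltr_ln.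
Qed.

Lemma logmean_scale c a b : 0 < c -> 0 < a -> 0 < b ->
  logmean (c * a) (c * b) = c * logmean a b.
Proof.
move=> c0 a0 b0; rewrite /logmean (inj_eq (mulfI (lt0r_neq0 c0))).
case: eqVneq => // _.
by rewrite !lnM ?posrE// opprD addrACA subrr add0r -mulrBr mulrA.
Qed.

(** Superadditivity applied to [(a, b)] and [(b, a)], whose sum is on the
    diagonal. *)
Lemma logmean_le_arith a b : 0 < a -> 0 < b -> logmean a b <= (a + b) / 2.
Proof.
move=> a0 b0; have := logmean_superadditive a0 b0 b0 a0.
rewrite [logmean b a]logmeanC [b + a]addrC {3}/logmean eqxx; lra.
Qed.

Lemma c_LS_logmean (p : R) : c_LS p = (logmean (1 - p) p)^-1.
Proof.
rewrite /c_LS /logmean; case: eqVneq => [->|pN]; last first.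
  case: eqVneq => [h|_]; last by rewrite invf_div.
  by case/eqP: pN; lra.
by rewrite (_ : 1 - 1 / 2 = 1 / 2 :> R); [rewrite eqxx; field|field].
Qed.

Lemma c_LS_gt0 (p : R) : 0 < p -> p < 1 -> 0 < c_LS p.
Proof.
by move=> p0 p1; rewrite c_LS_logmean invr_gt0 logmean_gt0// subr_gt0.
Qed.

Lemma c_LS_ge2 (p : R) : 0 < p -> p < 1 -> 2 <= c_LS p.
Proof.
move=> p0 p1; have q0 : 0 < 1 - p by rewrite subr_gt0.
have M0 := logmean_gt0 q0 p0.
rewrite c_LS_logmean -[2]invrK lef_pV2 ?posrE ?invr_gt0//.
by apply: le_trans (logmean_le_arith q0 p0) _; lra.
Qed.

(** The comparison of the logarithmic and arithmetic means of 2 and 1. *)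
Lemma ln2_ge : 2 / 3 <= ln 2 :> R.
Proof.
have l0 : 0 < ln 2 :> R by rewrite ln_gt0// ltr1n.
have := @logmean_le_arith 2 1 ltac:(lra) ltac:(lra).
rewrite /logmean ifF; last by apply/eqP; lra.
rewrite ln1 subr0 (_ : 2 - 1 = 1 :> R); last lra.
rewrite ler_pdivrMr//; lra.
Qed.

End LogarithmicMean.

(** * The log-Sobolev inequality on two points *)

Section TwoPoint.
Variable R : realType.
Implicit Types p q a b x y c : R.

(** Superadditivity of the logarithmic mean for [(x - 1, 1 - y) + (1, y) = (x, 1)].
    The constraint makes [(x - 1, 1 - y)] proportional to [(q, p)], and the
    common factor cancels. *)
Lemma two_point_ln_le p q x y : 0 < p -> 0 < q -> 1 < x -> 0 < y -> y < 1 ->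
  p * x + q * y = p + q ->
  p * ln x + q * ln y <= logmean q p * (ln x * ln y).
Proof.
move=> p0 q0 x1 y0 y1 pq.
have x0 : 0 < x by apply: lt_trans x1.
have s0 : 0 < x - 1 by rewrite subr_gt0.
have r0 : 0 < 1 - y by rewrite subr_gt0.
have h1 : 0 < ln x by exact: ln_gt0.
have h0 : 0 < - ln y by rewrite oppr_gt0 ln_lt0// y0 y1.
have := logmean_superadditive s0 r0 ltr01 y0; rewrite !subrK.
have k0 : 0 < (x - 1) / q by rewrite divr_gt0.
have rE : 1 - y = (x - 1) / q * p.
  apply: (mulfI (lt0r_neq0 q0)).
  have -> : q * ((x - 1) / q * p) = p * x - p by field; exact: lt0r_neq0.
  by rewrite mulrBr mulr1; lra.
have -> : logmean (x - 1) (1 - y) = (x - 1) / q * logmean q p.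
  by rewrite -logmean_scale// -rE divfK ?gt_eqF.
rewrite /logmean (gt_eqF y1) (gt_eqF x1) ln1 subr0 sub0r.
set M := (if q == p then _ else _).
have -> : (x - 1) / ln x = (x - 1) / q * (q / ln x).
  by field; rewrite !lt0r_neq0.
rewrite rE -[_ / q * p / _]mulrA -mulrDr ler_pM2l// => H.
have := ler_wpM2r (ltW (mulr_gt0 h1 h0)) H.
rewrite mulrDl.
have -> : p / - ln y * (ln x * - ln y) = p * ln x.
  by field; rewrite -oppr_eq0 lt0r_neq0.
have -> : q / ln x * (ln x * - ln y) = - (q * ln y).
  by field; rewrite lt0r_neq0.
lra.
Qed.

(** In [a] and [b] the difference of the two sides is a quadratic form; its
    coefficient of [b ^+ 2] is positive and [two_point_ln_le] says that its
    discriminant has the right sign. *)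
Lemma two_point_lsi_gt p q c a b x y : 0 < p -> 0 < q -> 1 < x -> 0 < y ->
  y < 1 -> p * x + q * y = p + q -> c = (logmean q p)^-1 ->
  p * (a ^+ 2 * ln x) + q * (b ^+ 2 * ln y) <= c * (p * q * (a - b) ^+ 2).
Proof.
move=> p0 q0 x1 y0 y1 pq cE.
have M0 := logmean_gt0 q0 p0.
have c0 : 0 < c by rewrite cE invr_gt0.
have K := two_point_ln_le p0 q0 x1 y0 y1 pq.
have {K} : c * (p * ln x + q * ln y) <= ln x * ln y.
  by rewrite cE ler_pdivrMl.
have h1 : 0 < ln x by exact: ln_gt0.
have h0 : 0 < - ln y by rewrite oppr_gt0 ln_lt0// y0 y1.
move: (ln x) (ln y) h1 h0 => h1 h0 h1p h0n K.
(* D is the coefficient of b ^+ 2; multiplying by it completes the square. *)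
pose D := c * p * q - q * h0.
have D0 : 0 < D.
  by rewrite /D -mulrN ltr_wpDl// ?mulr_gt0// !mulr_ge0// ltW.
rewrite -subr_ge0 -(pmulr_rge0 _ D0).
have -> : D * (c * (p * q * (a - b) ^+ 2) -
                (p * (a ^+ 2 * h1) + q * (b ^+ 2 * h0)))
  = (D * b - c * p * q * a) ^+ 2
    + a ^+ 2 * (p * q * (h1 * h0 - c * (p * h1 + q * h0))).
  by rewrite /D; ring.
rewrite addr_ge0 ?sqr_ge0// mulr_ge0 ?sqr_ge0//.
by rewrite mulr_ge0 ?subr_ge0// mulr_ge0// ltW.
Qed.

(** The density [(x, y)] has mean 1, so one value is above 1 and the other below,
    or both are 1; the two strict cases are exchanged by swapping the points. *)
Lemma two_point_lsi p a b x y : 0 < p -> p < 1 -> 0 < x -> 0 < y ->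
  p * x + (1 - p) * y = 1 ->
  p * (a ^+ 2 * ln x) + (1 - p) * (b ^+ 2 * ln y)
  <= c_LS p * (p * (1 - p) * (a - b) ^+ 2).
Proof.
move=> p0 p1 x0 y0 pq; have q0 : 0 < 1 - p by rewrite subr_gt0.
have [x1|x1|x1] := ltgtP x 1.
- have y1 : 1 < y.
    rewrite -subr_gt0 -(pmulr_rgt0 _ q0) mulrBr.
    have := mulr_gt0 p0 (_ : 0 < 1 - x); rewrite subr_gt0 mulrBr => /(_ x1).
    lra.
  rewrite addrC [p * (1 - p)]mulrC -[a - b]opprB sqrrN.
  apply: (two_point_lsi_gt _ _ q0 p0 y1 x0 x1); first by rewrite addrC pq subrK.
  by rewrite c_LS_logmean logmeanC.
- have y1 : y < 1.
    rewrite -subr_gt0 -(pmulr_rgt0 _ q0) mulrBr.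
    have := mulr_gt0 p0 (_ : 0 < x - 1); rewrite subr_gt0 mulrBr => /(_ x1).
    lra.
  apply: (two_point_lsi_gt _ _ p0 q0 x1 y0 y1); last exact: c_LS_logmean.
  by rewrite pq addrC subrK.
- have -> : y = 1.
    apply: (mulfI (lt0r_neq0 q0)); move: pq; rewrite x1; lra.
  rewrite x1 ln1 !mulr0 addr0 mulr_ge0 ?(ltW (c_LS_gt0 p0 p1))//.
  by rewrite mulr_ge0 ?sqr_ge0// mulr_ge0// ltW.
Qed.

End TwoPoint.

(** * Means on the cube, one coordinate at a time *)

Section Slices.
Variable R : realType.
Implicit Types (p : R) (n : nat).

Lemma bernoulli_weightE n p (x : cube n) :
  bernoulli_weight p x = \prod_(i < n) (if x i then p else 1 - p).
Proof.
rewrite /bernoulli_weight -!prodrXr -big_split /=.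
by apply: eq_bigr => i _; case: (x i); rewrite ?expr0 ?expr1 ?mulr1 ?mul1r.
Qed.

Lemma insert_coord_at n (i : 'I_n) u x : insert_coord i u x i = u.
Proof. by rewrite ffunE unlift_none. Qed.

Lemma insert_coord_lift n (i : 'I_n) u x k : insert_coord i u x (lift i k) = x k.
Proof. by rewrite ffunE liftK. Qed.

Lemma bernoulli_weight_insert n p (i : 'I_n) u x :
  bernoulli_weight p (insert_coord i u x)
  = (if u then p else 1 - p) * bernoulli_weight p x.
Proof.
rewrite !bernoulli_weightE (bigD1_ord i)//= insert_coord_at; congr (_ * _).
by apply: eq_bigr => k _; rewrite insert_coord_lift.
Qed.

Lemma sum_slice n (i : 'I_n) (G : cube n -> R) :
  \sum_y G y
  = \sum_(x : cube n.-1) (G (insert_coord i true x) + G (insert_coord i false x)).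
Proof.
rewrite (reindex (fun ux : bool * cube n.-1 => insert_coord i ux.1 ux.2)) /=.
  rewrite -(pair_bigA _ (fun u x => G (insert_coord i u x))) /= exchange_big /=.
  by apply: eq_bigr => x _; rewrite big_bool.
exists (fun y => (y i, [ffun k => y (lift i k)])) => [[u x] _ | y _] /=.
  rewrite insert_coord_at; congr (_, _); apply/ffunP => k.
  by rewrite ffunE insert_coord_lift.
by apply/ffunP => j; rewrite ffunE; case: unliftP => [k ->|->]; rewrite ?ffunE.
Qed.

Lemma bernoulli_mean_slice n p (i : 'I_n) (h : cube n -> R) :
  bernoulli_mean p h = bernoulli_mean p (fun x : cube n.-1 =>
    p * h (insert_coord i true x) + (1 - p) * h (insert_coord i false x)).
Proof.
rewrite /bernoulli_mean (sum_slice i); apply: eq_bigr => x _.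
by rewrite !bernoulli_weight_insert; ring.
Qed.

End Slices.

Section Mean.
Variables (R : realType) (p : R) (n : nat).
Hypotheses (p0 : 0 < p) (p1 : p < 1).
Implicit Types (g h : cube n -> R) (a : R) (x : cube n) (i j : 'I_n) (k : nat).

Local Notation mean := (@bernoulli_mean R n p).

Lemma eq_mean g h : g =1 h -> mean g = mean h.
Proof. by move=> gh; apply: eq_bigr => x _; rewrite gh. Qed.

Lemma meanD g h : mean (fun x => g x + h x) = mean g + mean h.
Proof. by rewrite -big_split; apply: eq_bigr => x _; rewrite mulrDr. Qed.

Lemma meanZ a g : mean (fun x => a * g x) = a * mean g.
Proof. by rewrite /bernoulli_mean big_distrr; apply: eq_bigr => x _; rewrite mulrCA. Qed.

Lemma meanN g : mean (fun x => - g x) = - mean g.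
Proof. by rewrite -mulN1r -meanZ; apply: eq_mean => x; rewrite mulN1r. Qed.

Lemma meanB g h : mean (fun x => g x - h x) = mean g - mean h.
Proof. by rewrite meanD meanN. Qed.

Lemma bernoulli_weight_ge0 x : 0 <= bernoulli_weight p x.
Proof. by rewrite mulr_ge0// exprn_ge0// ltW// subr_gt0. Qed.

Lemma ler_mean g h : (forall x, g x <= h x) -> mean g <= mean h.
Proof.
by move=> gh; apply: ler_sum => x _; rewrite ler_wpM2l ?bernoulli_weight_ge0.
Qed.

Lemma mean_ge0 g : (forall x, 0 <= g x) -> 0 <= mean g.
Proof.
by move=> g0; apply: sumr_ge0 => x _; rewrite mulr_ge0 ?bernoulli_weight_ge0.
Qed.

End Mean.

Lemma mean_cst (R : realType) (p : R) n (a : R) :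
  bernoulli_mean p (fun _ : cube n => a) = a.
Proof.
elim: n => [|n IH]; last first.
  rewrite (bernoulli_mean_slice _ ord0) -[RHS]IH; apply: eq_mean => x; ring.
rewrite /bernoulli_mean (bigD1 [ffun=> false])//= big1 => [|x /eqP[]].
  by rewrite bernoulli_weightE big_ord0 mul1r addr0.
by apply/ffunP => -[].
Qed.

Lemma bernoulli_varianceE (R : realType) (p : R) n (g : cube n -> R) :
  bernoulli_variance p g
  = bernoulli_mean p (fun x => g x ^+ 2) - bernoulli_mean p g ^+ 2.
Proof.
rewrite /bernoulli_variance; set m := bernoulli_mean p g.
have -> : bernoulli_mean p (fun x => (g x - m) ^+ 2)
  = bernoulli_mean p (fun x => g x ^+ 2 + - (2 * m) * g x + m ^+ 2).
  by apply: eq_mean => x; ring.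
by rewrite !meanD mean_cst meanZ -/m; ring.
Qed.

(** * Averaging operators and the martingale decomposition *)

Section Averaging.
Variables (R : realType) (p : R) (n : nat).
Hypotheses (p0 : 0 < p) (p1 : p < 1).
Implicit Types (g h : cube n -> R) (a : R) (x y : cube n) (i j : 'I_n) (k : nat).

Local Notation mean := (@bernoulli_mean R n p).

Definition set_coord i u x : cube n := [ffun j => if j == i then u else x j].

Definition avg i g x : R :=
  p * g (set_coord i true x) + (1 - p) * g (set_coord i false x).

Definition fluct i g x := g x - avg i g x.

(** The conditional expectation of [g] given the coordinates [k, k + 1, ...].
    Taking [k : nat] rather than an ordinal lets the sums over [k] telescope. *)
Definition avg_below g := fix A k :=
  if k is k'.+1 then
    if insub k' is Some i then avg i (A k') else A k'
  else g.

Definition mart_diff k g x := avg_below g k x - avg_below g k.+1 x.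

Definition energy g := \sum_(i < n) mean (fun x => fluct i g x ^+ 2).

Lemma set_coord_idem i u v x : set_coord i u (set_coord i v x) = set_coord i u x.
Proof. by apply/ffunP => j; rewrite !ffunE; case: eqP. Qed.

Lemma set_coord_comm i j u v x : i != j ->
  set_coord i u (set_coord j v x) = set_coord j v (set_coord i u x).
Proof.
move=> ij; apply/ffunP => k; rewrite !ffunE.
by case: eqP => // ->; rewrite (negPf ij).
Qed.

Lemma set_coord_insert i u v (x : cube n.-1) :
  set_coord i u (insert_coord i v x) = insert_coord i u x.
Proof.
by apply/ffunP => j; rewrite !ffunE; case: unliftP => [k ->|->];
  rewrite ?eqxx // eq_sym (negPf (neq_lift _ _)).
Qed.

Lemma avg_insert i g u (x : cube n.-1) :
  avg i g (insert_coord i u x)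
  = p * g (insert_coord i true x) + (1 - p) * g (insert_coord i false x).
Proof. by rewrite /avg !set_coord_insert. Qed.

Lemma mean_avg i g : mean (avg i g) = mean g.
Proof.
rewrite !(bernoulli_mean_slice _ i); apply: eq_mean => x.
by rewrite !avg_insert; ring.
Qed.

Lemma avg_set_coord i g u x : avg i g (set_coord i u x) = avg i g x.
Proof. by rewrite /avg !set_coord_idem. Qed.

Lemma avg_comm i j g : avg i (avg j g) = avg j (avg i g).
Proof.
have [->//|ij] := eqVneq i j; apply/funext => x.
by rewrite /avg !(set_coord_comm _ _ _ ij); ring.
Qed.

Lemma avgB i g h : avg i (fun x => g x - h x) = fun x => avg i g x - avg i h x.
Proof. by apply/funext => x; rewrite /avg; ring. Qed.

Lemma fluct_avg_comm i j g : fluct i (avg j g) = avg j (fluct i g).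
Proof. by rewrite {2}/fluct avgB -avg_comm. Qed.

Lemma fluctB i g h :
  fluct i (fun x => g x - h x) = fun x => fluct i g x - fluct i h x.
Proof. by apply/funext => x; rewrite /fluct avgB; ring. Qed.

Lemma mean_fluct i g : mean (fluct i g) = 0.
Proof. by rewrite meanB mean_avg subrr. Qed.

(** Pythagoras: [avg i] is an orthogonal projection. *)
Lemma mean_fluct_sqr i g : mean (fun x => fluct i g x ^+ 2)
  = mean (fun x => g x ^+ 2) - mean (fun x => avg i g x ^+ 2).
Proof.
rewrite -meanB -[LHS](mean_avg i) -[RHS](mean_avg i); apply: eq_mean => x.
by rewrite /fluct /avg !set_coord_idem; ring.
Qed.

Lemma avg_fluct_sqr i g x : avg i (fun y => fluct i g y ^+ 2) x
  = p * (1 - p) * (g (set_coord i true x) - g (set_coord i false x)) ^+ 2.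
Proof. by rewrite /fluct /avg !set_coord_idem; ring. Qed.

Lemma avg_gt0 i g : (forall x, 0 < g x) -> forall x, 0 < avg i g x.
Proof. by move=> g0 x; rewrite addr_gt0// mulr_gt0// subr_gt0. Qed.

Lemma avg_belowS g i : avg_below g i.+1 = avg i (avg_below g i).
Proof. by rewrite /= valK. Qed.

Lemma avg_below_ind (P : (cube n -> R) -> Prop) g k :
  P g -> (forall i h, P h -> P (avg i h)) -> P (avg_below g k).
Proof.
by move=> Pg PA; elim: k => // k IH /=; case: insubP => // i _ _; exact: PA.
Qed.

Lemma mean_avg_below g k : mean (avg_below g k) = mean g.
Proof.
by apply: (avg_below_ind (P := fun h => mean h = mean g)) => // i h; rewrite mean_avg.
Qed.

Lemma avg_below_gt0 g k : (forall x, 0 < g x) -> forall x, 0 < avg_below g k x.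
Proof.
move=> g0; apply: (avg_below_ind (P := fun h => forall x, 0 < h x)) => // i h.
exact: avg_gt0.
Qed.

Lemma fluct_avg_below i g k : fluct i (avg_below g k) = avg_below (fluct i g) k.
Proof.
elim: k => //= k IH; case: insub => [j|//].
by rewrite fluct_avg_comm IH.
Qed.

Lemma avg_below_agree g k x y : (forall i, (k <= i)%N -> x i = y i) ->
  (k <= n)%N -> avg_below g k x = avg_below g k y.
Proof.
elim: k x y => [|k IH] x y xy kn.
  by congr g; apply/ffunP => i; exact: xy.
rewrite (avg_belowS g (Ordinal kn)) /avg.
have xyk u (i : 'I_n) : (k <= i)%N ->
    set_coord (Ordinal kn) u x i = set_coord (Ordinal kn) u y i.
  move=> ki; rewrite !ffunE; case: eqP => // ik; apply: xy.
  by rewrite ltn_neqAle ki andbT; apply/eqP => kE; apply: ik; apply: val_inj.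
by rewrite !(IH _ _ (xyk _) (ltnW kn)).
Qed.

Lemma avg_below_all g x : avg_below g n x = mean g.
Proof.
rewrite -(mean_avg_below g n) -[LHS](mean_cst p n); apply: eq_mean => y.
by apply: avg_below_agree => // i; rewrite leqNgt ltn_ord.
Qed.

Lemma mart_diffE i g : mart_diff i g = avg_below (fluct i g) i.
Proof. by rewrite -fluct_avg_below; apply/funext => x; rewrite /mart_diff avg_belowS. Qed.

Lemma fluct_mart_diff i k g : fluct i (mart_diff k g) = mart_diff k (fluct i g).
Proof. by rewrite /mart_diff fluctB !fluct_avg_below. Qed.

Lemma telescope_ord (a : nat -> R) : \sum_(i < n) (a i - a i.+1) = a 0%N - a n.
Proof.
rewrite -(big_mkord xpredT (fun k => a k - a k.+1)) -opprB -telescope_sumr//.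
by rewrite -sumrN; apply: eq_bigr => k _; rewrite opprB.
Qed.

(** By Pythagoras each term is a difference of consecutive second moments, from
    [g] itself down to its constant average. *)
Lemma sum_mart_diff_sqr g : \sum_(k < n) mean (fun x => mart_diff k g x ^+ 2)
  = mean (fun x => g x ^+ 2) - mean g ^+ 2.
Proof.
rewrite -[X in _ - X](mean_cst p n).
under [X in _ - X]eq_mean => x do rewrite -(avg_below_all g x).
rewrite -(telescope_ord (fun k => mean (fun x => avg_below g k x ^+ 2))).
by apply: eq_bigr => k _; rewrite avg_belowS -mean_fluct_sqr /mart_diff avg_belowS.
Qed.

(** [fluct i] commutes with [mart_diff k], so the left-hand side regroups into
    the martingale decompositions of the functions [fluct i g], which are
    centred. *)
Lemma sum_energy_mart_diff g : \sum_(k < n) energy (mart_diff k g) = energy g.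
Proof.
rewrite /energy exchange_big; apply: eq_bigr => i _ /=.
under eq_bigr => k _ do rewrite fluct_mart_diff.
by rewrite sum_mart_diff_sqr mean_fluct expr0n subr0.
Qed.

Lemma mean_avg_sqr_le i g :
  mean (fun x => avg i g x ^+ 2) <= mean (fun x => g x ^+ 2).
Proof. by rewrite -subr_ge0 -mean_fluct_sqr mean_ge0// => x; rewrite sqr_ge0. Qed.

(** The Efron-Stein inequality: a martingale difference is a conditional
    expectation of a fluctuation, and these contract the L2 norm. *)
Lemma variance_le_energy g : bernoulli_variance p g <= energy g.
Proof.
rewrite bernoulli_varianceE -sum_mart_diff_sqr; apply: ler_sum => i _.
rewrite mart_diffE; apply: (avg_below_ind
  (P := fun h => mean (fun x => h x ^+ 2) <= mean (fun x => fluct i g x ^+ 2))) => //.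
by move=> j h; apply: le_trans; exact: mean_avg_sqr_le.
Qed.

Lemma mean_norm_mart_diff i g :
  mean (fun x => `|mart_diff i g x|) <= mean (fun x => `|fluct i g x|).
Proof.
rewrite mart_diffE; apply: (avg_below_ind
  (P := fun h => mean (fun x => `|h x|) <= mean (fun x => `|fluct i g x|))) => //.
move=> j h; apply: le_trans; rewrite -[leRHS](mean_avg j).
apply: ler_mean => // x; apply: le_trans (ler_normD _ _) _.
have q0 : 0 < 1 - p by rewrite subr_gt0.
by rewrite !normrM (gtr0_norm p0) (gtr0_norm q0).
Qed.

(** The tensorization step: once the other coordinates are fixed,
    [psi / avg i psi] is a density on two points. *)
Lemma coord_lsi i g psi : (forall x, 0 < psi x) ->
  mean (fun x => g x ^+ 2 * (ln (psi x) - ln (avg i psi x)))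
  <= c_LS p * mean (fun x => fluct i g x ^+ 2).
Proof.
move=> psi0; rewrite -meanZ -[leLHS](mean_avg i) -[leRHS](mean_avg i).
apply: ler_mean => // x.
have a0 := avg_gt0 i psi0 x.
have -> : avg i (fun y => c_LS p * fluct i g y ^+ 2) x
  = c_LS p * avg i (fun y => fluct i g y ^+ 2) x by rewrite /avg; ring.
rewrite avg_fluct_sqr {1}/avg !avg_set_coord -!ln_div ?posrE ?divr_gt0//.
apply: two_point_lsi; rewrite ?divr_gt0// !mulrA -mulrDl.
by rewrite divff// gt_eqF.
Qed.

(** [ln phi] telescopes along the conditional expectations of [phi], which end
    at the constant 1; each increment is controlled by [coord_lsi]. *)
Lemma log_sobolev g phi : (forall x, 0 < phi x) -> mean phi = 1 ->
  mean (fun x => g x ^+ 2 * ln (phi x)) <= c_LS p * energy g.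
Proof.
move=> phi0 phi1.
pose a k := mean (fun x => g x ^+ 2 * ln (avg_below phi k x)).
have -> : mean (fun x => g x ^+ 2 * ln (phi x)) = a 0%N - a n.
  rewrite [a n](_ : _ = 0) ?subr0//.
  rewrite -[RHS](mean_cst p n); apply: eq_mean => x.
  by rewrite avg_below_all phi1 ln1 mulr0.
rewrite -telescope_ord /energy mulr_sumr; apply: ler_sum => i _.
rewrite -meanB; apply: le_trans (coord_lsi i g (avg_below_gt0 i phi0)).
by rewrite le_eqVlt; apply/orP; left; apply/eqP/eq_mean => x;
  rewrite avg_belowS mulrBr.
Qed.

(** The log-Sobolev inequality tested against a density close to
    [|g| / E |g|].  The optimal [a] would be the ratio of [E g^2] to [E |g|];
    it is left free so that one value serves all martingale differences. *)
Lemma energy_ge g (a W : R) : 0 < a -> mean (fun x => `|g x|) < W ->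
  mean (fun x => g x ^+ 2) * (ln a + 1 - ln W) - a * mean (fun x => `|g x|)
  <= c_LS p * energy g.
Proof.
set w := mean (fun x => `|g x|) => k0 wW.
have W0 : 0 < W by apply: le_lt_trans wW; apply: mean_ge0.
have d0 : 0 < W - w by rewrite subr_gt0.
(* Adding W - w keeps the density positive at the zeros of g. *)
pose phi x := W^-1 * (`|g x| + (W - w)).
have phi0 x : 0 < phi x by rewrite mulr_gt0 ?invr_gt0// ltr_wpDl.
have phi1 : mean phi = 1.
  by rewrite meanZ meanD mean_cst -/w addrC subrK mulVf ?gt_eqF.
apply: le_trans (log_sobolev g phi0 phi1).
rewrite mulrC -!meanZ -meanB; apply: ler_mean => // x.
set y := `|g x| + (W - w).
have y0 : 0 < y by rewrite ltr_wpDl.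
rewrite /phi -/y lnM ?posrE ?invr_gt0// lnV ?posrE//.
(* ln y is convex in 1 / y: its tangent at y = a plays the role of Jensen. *)
have H : ln a + 1 - a / y <= ln y by have := ln_tangent_le k0 y0; lra.
have := ler_wpM2l (sqr_ge0 (g x)) H.
have : g x ^+ 2 * (a / y) <= a * `|g x|.
  rewrite mulrCA ler_pM2l// -real_normK ?num_real// expr2 -mulrA.
  rewrite ler_piMr// ler_pdivrMr// mul1r.
  by rewrite lerDl ltW.
move: (ln a) (ln y) (ln W) (a / y) (a * _) (g x ^+ 2) => A B C D E F.
by rewrite !mulrDr !mulrN !mulrDl ![_ * F]mulrC; lra.
Qed.

End Averaging.

(** * Influences of Boolean functions *)

Section Influence.
Variables (R : realType) (p : R) (n : nat).
Hypotheses (p0 : 0 < p) (p1 : p < 1).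
Variable f : cube n -> bool.

Local Notation F := (fun x => (f x)%:R : R).

Lemma constant_on_line i x :
  constant_on f (line i x)
  = (f (insert_coord i true x) == f (insert_coord i false x)).
Proof.
have on_line u : insert_coord i u x \in line i x by exact: imset_f.
apply/idP/eqP => [/forall_inP/(_ _ (on_line true))|fE].
  by move=> /forall_inP/(_ _ (on_line false))/eqP.
apply/forall_inP => _ /imsetP[u _ ->]; apply/forall_inP => _ /imsetP[v _ ->].
by case: u v => -[]; rewrite ?fE.
Qed.

Lemma influenceE i : influence p f i = bernoulli_mean p (fun x : cube n.-1 =>
  (f (insert_coord i true x) != f (insert_coord i false x))%:R).
Proof.
rewrite /influence /bernoulli_measure /bernoulli_mean big_mkcond.
apply: eq_bigr => x _; rewrite inE constant_on_line.
by case: eqP; rewrite ?mulr0 ?mulr1.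
Qed.

Lemma mean_fluct_bool_sqr i :
  bernoulli_mean p (fun x => fluct p i F x ^+ 2) = p * (1 - p) * influence p f i.
Proof.
rewrite (bernoulli_mean_slice _ i) influenceE -meanZ; apply: eq_mean => x.
rewrite /fluct !avg_insert.
by case: (f _); case: (f _); rewrite ?eqxx /=; ring.
Qed.

Lemma mean_norm_fluct_bool i :
  bernoulli_mean p (fun x => `|fluct p i F x|)
  = 2 * (p * (1 - p)) * influence p f i.
Proof.
have q0 : 0 < 1 - p by rewrite subr_gt0.
have pq1 : p + (1 - p) = 1 by ring.
rewrite (bernoulli_mean_slice _ i) influenceE -meanZ; apply: eq_mean => x.
rewrite /fluct !avg_insert.
case: (f _); case: (f _); rewrite ?eqxx /= ?mulr1 ?mulr0 ?addr0 ?add0r ?sub0r.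
- by rewrite pq1 subrr normr0 !mulr0 addr0.
- by rewrite normrN (gtr0_norm p0) (gtr0_norm q0); ring.
- by rewrite normrN subKr (gtr0_norm p0) (gtr0_norm q0); ring.
- by rewrite normrN normr0 !mulr0 addr0.
Qed.

Lemma energy_bool : energy p F = p * (1 - p) * \sum_(i < n) influence p f i.
Proof.
by rewrite mulr_sumr; apply: eq_bigr => i _; exact: mean_fluct_bool_sqr.
Qed.

Lemma variance_bool_le : bernoulli_variance p F <= 1 / 4.
Proof.
rewrite bernoulli_varianceE.
rewrite (_ : bernoulli_mean p (fun x => F x ^+ 2) = bernoulli_mean p F).
  set m := bernoulli_mean p F; have := sqr_ge0 (m - 1 / 2); nra.
by apply: eq_mean => x; case: (f x); rewrite ?expr0n ?expr1n.
Qed.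

Lemma influence_le_max i : influence p f i <= max_influence p f.
Proof. exact: le_bigmax. Qed.

Lemma max_influence_ge0 : 0 <= max_influence p f.
Proof. by apply: bigmax_ge_id. Qed.

Lemma sum_influence_le : \sum_(i < n) influence p f i <= n%:R * max_influence p f.
Proof.
rewrite -[n in n%:R]card_ord mulr_natl -sumr_const; apply: ler_sum => i _.
exact: influence_le_max.
Qed.

End Influence.

(** * The lower bound on the largest influence *)

Section Conclusion.
Variable R : realType.

(** Sum [energy_ge] over the martingale differences.  The strict bound
    [W = 4 r m] is twice the bound [2 r m] on the L1 norms, which costs only a
    factor 2 inside the logarithm. *)
Lemma variance_log_le (p : R) (n : nat) (f : cube n -> bool) :
  let V := bernoulli_variance p (fun x => (f x)%:R) in
  let m := max_influence p f in
  0 < p -> p < 1 -> (0 < n)%N -> 0 < V -> 0 < m ->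
  V * ln (V / (8 * (p * (1 - p)) ^+ 2 * n%:R * m ^+ 2))
  <= c_LS p * (p * (1 - p) * (n%:R * m)).
Proof.
move=> V m p0 p1 n0 V0 m0.
have q0 : 0 < 1 - p by rewrite subr_gt0.
have r0 : 0 < p * (1 - p) by rewrite mulr_gt0.
set r := p * (1 - p) in r0 *.
have N0 : 0 < n%:R :> R by rewrite ltr0n.
pose F (x : cube n) : R := (f x)%:R.
(* K makes the total of the L1 terms at most V, cancelling the + 1. *)
pose K := V / (2 * r * (n%:R * m)).
pose W := 4 * r * m.
have K0 : 0 < K by rewrite divr_gt0// !mulr_gt0.
have W0 : 0 < W by rewrite !mulr_gt0.
have norm_le (j : 'I_n) :
    bernoulli_mean p (fun x => `|mart_diff p j F x|) <= 2 * r * influence p f j.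
  by rewrite -mean_norm_fluct_bool//; exact: mean_norm_mart_diff.
have norm_lt (j : 'I_n) : bernoulli_mean p (fun x => `|mart_diff p j F x|) < W.
  apply: le_lt_trans (norm_le j) _.
  have : 2 * r * influence p f j <= 2 * r * m.
    by rewrite ler_pM2l ?influence_le_max// mulr_gt0.
  by have := mulr_gt0 r0 m0; rewrite /W; lra.
have : \sum_(j < n) (bernoulli_mean p (fun x => mart_diff p j F x ^+ 2)
    * (ln K + 1 - ln W) - K * bernoulli_mean p (fun x => `|mart_diff p j F x|))
    <= c_LS p * (r * (n%:R * m)).
  apply: (le_trans (ler_sum _ (fun j _ => energy_ge p0 p1 K0 (norm_lt j)))).
  rewrite -mulr_sumr sum_energy_mart_diff// energy_bool// -/r.
  by rewrite ler_pM2l ?c_LS_gt0// ler_pM2l// sum_influence_le.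
rewrite sumrB -mulr_suml sum_mart_diff_sqr// -bernoulli_varianceE -/V -mulr_sumr.
have : K * \sum_(j < n) bernoulli_mean p (fun x => `|mart_diff p j F x|) <= V.
  have -> : V = K * (2 * r * (n%:R * m)).
    by rewrite divfK// gt_eqF// !mulr_gt0.
  rewrite ler_pM2l//; apply: le_trans (ler_sum _ (fun j _ => norm_le j)) _.
  by rewrite -mulr_sumr ler_pM2l ?sum_influence_le// mulr_gt0.
have -> : V / (8 * r ^+ 2 * n%:R * m ^+ 2) = K / W.
  by rewrite /K /W; field; rewrite !lt0r_neq0.
rewrite ln_div ?posrE//; lra.
Qed.

(** Suppose [t < L - 2 ln L] with [L = ln n].  If [L >= 1] then [t < L], so
    [t + 2 ln t < L], against the hypothesis.  If [L < 1] then [L >= ln 2 >= 2/3]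
    gives [L - 2 ln L <= 2 <= t]. *)
Lemma s_le_of_ln_le (n : nat) (t : R) : (2 <= n)%N -> 2 <= t ->
  ln n%:R - 2 * ln t <= t -> s R n <= t.
Proof.
move=> n2 t2 tn; set L : R := ln n%:R in tn *.
have L_ge : 2 / 3 <= L.
  apply: le_trans (ln2_ge R) _.
  by rewrite ler_ln ?posrE ?ltr0n ?ler_nat// (leq_trans _ n2).
have L0 : 0 < L by apply: lt_le_trans L_ge; lra.
have t0 : 0 < t by apply: lt_le_trans t2; lra.
have sL : s R n <= L - 2 * ln L.
  by rewrite /s lerB// le_max lexx orbT.
apply: le_trans sL _; rewrite leNgt; apply/negP => tL.
have [L1|L1] := leP 1 L.
  have L2 : ln t < ln L.
    rewrite ltr_ln ?posrE//; apply: lt_le_trans tL _.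
    by have := ln_ge0 L1; lra.
  lra.
have : - ln L <= L^-1 - 1 by rewrite -lnV ?posrE// ln_le_subr1// invr_gt0.
have : L^-1 <= 3 / 2 by rewrite -[3 / 2]invf_div lef_pV2 ?posrE//; lra.
lra.
Qed.

End Conclusion.

Theorem theorem4p2 (R : realType) (n : nat) (hn : (2 <= n)%N) (p : R)
    (hp0 : 0 < p) (hp1 : p < 1) (f : cube n -> bool) :
  bernoulli_variance p (fun x => (f x)%:R) * s R n
    / (n%:R * p * (1 - p) * c_LS p)
  <= max_influence p f.
Proof.
have q0 : 0 < 1 - p by rewrite subr_gt0.
have r0 : 0 < p * (1 - p) by rewrite mulr_gt0.
have c0 := c_LS_gt0 hp0 hp1.
have c2 := c_LS_ge2 hp0 hp1.
have n0 : (0 < n)%N by apply: leq_trans hn.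
have N0 : 0 < n%:R :> R by rewrite ltr0n.
have m0 := max_influence_ge0 p f.
have V4 := variance_bool_le p f.
have Vm := variance_le_energy hp0 hp1 (fun x : cube n => (f x)%:R).
rewrite energy_bool in Vm.
have {Vm} Vm := le_trans Vm (ler_wpM2l (ltW r0) (sum_influence_le p f)).
have := @variance_log_le R p n f hp0 hp1 n0.
set V := bernoulli_variance _ _ in V4 Vm *; set m := max_influence p f in m0 Vm *.
set r := p * (1 - p) in r0 Vm *; set c := c_LS p in c0 c2 *.
move=> /= ent.
have D0 : 0 < n%:R * r * c by rewrite !mulr_gt0.
rewrite -[n%:R * p * _]mulrA -/r ler_pdivrMr//.
have [V0|V0] := leP V 0.
  have -> : V = 0.
    by apply/le_anti; rewrite V0 mean_ge0// => x; rewrite sqr_ge0.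
  by rewrite mul0r mulr_ge0// ltW.
have {}m0 : 0 < m.
  by have := lt_le_trans V0 Vm; rewrite pmulr_rgt0// pmulr_rgt0.
pose t := c * (r * (n%:R * m)) / V.
have -> : m * (n%:R * r * c) = V * t.
  by rewrite /t; field; rewrite lt0r_neq0.
rewrite ler_pM2l//; apply: s_le_of_ln_le => //.
  rewrite ler_pdivlMr//; apply: le_trans (ler_wpM2l _ Vm) _ => //.
  by rewrite ler_pM2r// !mulr_gt0.
have t0 : 0 < t by rewrite divr_gt0// !mulr_gt0.
have {ent} ent : ln (V / (8 * r ^+ 2 * n%:R * m ^+ 2)) <= t.
  by rewrite ler_pdivlMr// mulrC ent.
apply: le_trans ent.
have -> : ln n%:R - 2 * ln t = ln (n%:R / t ^+ 2).
  by rewrite [RHS]ln_div ?posrE ?exprn_gt0// lnXn// mulr_natl.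
rewrite ler_ln ?posrE ?divr_gt0 ?mulr_gt0 ?invr_gt0 ?exprn_gt0//.
have -> : n%:R / t ^+ 2 = V / (8 * r ^+ 2 * n%:R * m ^+ 2) * (8 * V / c ^+ 2).
  by rewrite /t; field; rewrite !lt0r_neq0.
rewrite ler_piMr//; first by rewrite ltW// divr_gt0 ?mulr_gt0 ?exprn_gt0.
rewrite ler_pdivrMr ?exprn_gt0// mul1r.
have : 2 * 2 <= c * c by apply: ler_pM.
by rewrite -expr2; lra.
Qed.
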